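(* Let $X_1,X_2,\ldots$ be jointly normal with $X_i\sim\mathcal N(\mu_i,1)$, $\mu_i\ge 0$, and for each $n$ let $\Sigma_n$ be the correlation matrix of $(X_1,\ldots,X_n)$, with $(i,j)$-th entry $\rho_{ij}$ for $i\neq j$, where $\liminf \rho_{ij}=\delta>0$. Suppose $\mu^\star=\sup_i\mu_i<\infty$. Then, for any $\alpha\in(0,1)$, $$\lim_{n\to\infty} FWER_{Holm}(n,\alpha,\Sigma_n)=0$$ under any configuration of true and false null hypotheses (i.e. whatever the set of indices $i$ with $\mu_i=0$).
   Context: Testing problem: for each $n$, observe $(X_1,\ldots,X_n)$ jointly normal with $X_i\sim\mathcal N(\mu_i,1)$ and $\operatorname{Corr}(X_i,X_j)=\rho_{ij}\ge 0$ for $i\ne j$. Test $H_{0i}:\mu_i=0$ against $H_{1i}:\mu_i>0$, $1\le i\le n$ (so always $\mu_i\ge0$). The p-values are $P_i=1-\Phi(X_i)$, with $\Phi$ the standard normal distribution function, and $P_{(1)}\le\cdots\le P_{(n)}$ are the ordered p-values, with corresponding null hypotheses $H_{(1)},\ldots,H_{(n)}$. The array $(\rho_{ij})$ does not depend on $n$, and $\liminf\rho_{ij}$ denotes the lower limit as $i,j\to\infty$ with $i\neq j$. For a multiple testing procedure $T$, $V_n(T)$ is the number of type I errors (rejected hypotheses $H_{0i}$ with $\mu_i=0$), and $FWER_T(n,\alpha,\Sigma_n)=\mathbb P_{\Sigma_n}(V_n(T)\ge1)$, where $\alpha$ is the target level used in defining $T$. Holm's procedure is the step-down procedure with cutoffs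 $u_i=\alpha/(n-i+1)$, $i=1,\ldots,n$: it rejects $H_{(1)},\ldots,H_{(m)}$ where $m=\max\{i: P_{(j)}\le u_j \text{ for all } j=1,\ldots,i\}$, and rejects nothing if no such $i$ exists. *)

(* Defs.v *)
From HB Require Import structures.
From mathcomp Require Import all_boot all_order all_algebra.
From mathcomp Require Import all_classical all_reals all_analysis.

Set Implicit Arguments.
Unset Strict Implicit.
Unset Printing Implicit Defensive.

Import Order.TTheory GRing.Theory Num.Theory.
Import numFieldNormedType.Exports.

Local Open Scope classical_set_scope.
Local Open Scope ring_scope.

Section normal_variables.
Context {d : measure_display} {T : measurableType d} {R : realType}.
Variable P : probability T R.

(* The library's [normal_prob m 0] is the uniform law on [0, 1]; the degenerate
   normal law is the point mass at [m]. *)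
Definition normal_law (m s : R) (A : set R) : \bar R :=
  if s == 0 then dirac m A else normal_prob m s A.

(* Only measurable [A] are compared: on other sets the values of measures carry
   no meaning. [s] is the standard deviation. *)
Definition has_normal_law (Y : T -> R) (m s : R) : Prop :=
  forall A : set R, measurable A -> P (Y @^-1` A) = normal_law m s A.

Definition jointly_normal (X : nat -> T -> R) : Prop :=
  forall (n : nat) (c : 'I_n -> R), exists m s : R,
    0 <= s /\ has_normal_law (fun w => \sum_(i < n) c i * X i w) m s.

Definition correlation (Y Z : T -> R) : R :=
  fine (covariance P Y Z) /
    (Num.sqrt (fine (variance P Y)) * Num.sqrt (fine (variance P Z))).

Definition correlation_mx (X : nat -> T -> R) (n : nat) : 'M[R]_n :=
  \matrix_(i, j) correlation (X i) (X j).

End normal_variables.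

(* Lower limit of [rho i j] as [i] and [j] both tend to infinity, [i != j]. *)
Definition liminf_offdiag {R : realType} (rho : nat -> nat -> R) : \bar R :=
  limf_einf (fun ij : nat * nat => (rho ij.1 ij.2)%:E)
    (within [set ij | ij.1 != ij.2] (filter_prod \oo \oo)).

Section multiple_testing.
Context {R : realType}.

Definition std_normal_cdf (x : R) : R := fine (normal_prob 0 1 `]-oo, x]).

Definition pvalue (x : R) : R := 1 - std_normal_cdf x.

(* A procedure for [n] hypotheses maps the p-values to the rejected indices;
   hypotheses are indexed from 0. *)
Definition procedure (n : nat) := ('I_n -> R) -> {set 'I_n}.

Section step_down.
Variable n : nat.

(* H_(1), ..., H_(n); ties between p-values are broken by the index. *)
Definition ordered_hyp (p : 'I_n -> R) : seq 'I_n :=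
  sort (fun i j => p i <= p j) (enum 'I_n).

(* P_(k) for k = 1, ..., n (positions are counted from 1). *)
Definition ordered_pvalue (p : 'I_n -> R) (k : nat) : R :=
  nth 0 (map p (ordered_hyp p)) k.-1.

(* The largest i in {1, ..., n} with P_(j) <= u j for all j = 1, ..., i, and 0
   if there is none. *)
Definition step_down_count (u : nat -> R) (p : 'I_n -> R) : nat :=
  \max_(1 <= i < n.+1 | all (fun j => ordered_pvalue p j <= u j) (iota 1 i)) i.

Definition step_down (u : nat -> R) : procedure n :=
  fun p => [set i in take (step_down_count u p) (ordered_hyp p)].

End step_down.

Definition holm (alpha : R) (n : nat) : procedure n :=
  step_down (fun i => alpha / (n - i + 1)%:R).

Definition type_I_errors (mu : nat -> R) (n : nat) (A : {set 'I_n}) : nat :=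
  #|[set i in A | mu i == 0]|.

(* The law of (X_0, ..., X_(n-1)), hence its correlation matrix, enters through
   [P] and [X]. *)
Definition FWER {d : measure_display} {T : measurableType d}
    (P : probability T R) (mu : nat -> R) (X : nat -> T -> R)
    (proc : R -> forall n, procedure n) (n : nat) (alpha : R) : \bar R :=
  P [set w | (1 <= type_I_errors mu
                     (proc alpha n (fun i : 'I_n => pvalue (X i w))))%N].

End multiple_testing.

(* Main.v *)
Require Import Defs.
From HB Require Import structures.
From mathcomp Require Import all_boot all_order all_algebra.
From mathcomp Require Import all_classical all_reals all_analysis.
From mathcomp Require Import measurable_realfun zify ring lra.

(** The first comparison made by Holm's procedure is the Bonferroni one, so a
    type I error forces [1 - Phi(X_i) <= alpha / n] for some [i], that is
    [X_i >= t - 2] with [t = sqrt (2 ln n)] once [n] is large. Choose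
    [0 < r < min(delta, 1)] and an index [N] such that [rho_ij >= r] for all
    distinct [i, j >= N], and use the single variable [X_N] as a proxy for the
    common factor: for [i > N] the residual [X_i - r X_N] is normal with
    variance [1 - 2 r rho_iN + r^2 <= 1 - r^2]. With [e = r^2 / 4], an
    exceedance [X_i >= t - 2] implies [r X_N >= e t] or
    [X_i - r X_N >= (1 - e) t - 2]. The first event does not depend on [i] and
    has vanishing probability; the Chernoff bound with parameter [t] gives the
    second one probability at most [exp (- t^2 / 2 - r^2 t^2 / 4 + O(t))],
    which is [o(1 / n)], so that a union bound over [i] concludes. The first
    [N + 1] indices are negligible. *)

Set Implicit Arguments.
Unset Strict Implicit.
Unset Printing Implicit Defensive.

Import Order.TTheory GRing.Theory Num.Theory.
Import numFieldNormedType.Exports.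

Local Open Scope classical_set_scope.
Local Open Scope ring_scope.

(** * Exponential moments, tails and integrals for normal laws *)

Section normal_distribution.
Context {R : realType}.
Implicit Types (m s l x : R) (A : set R).
Local Notation leb := (@lebesgue_measure R).

(** Completing the square: an exponential tilt by [l] moves the mean by [l * s ^+ 2], up to a
    constant factor. *)
Lemma expR_mul_normal_pdf m s l x : s != 0 ->
  expR (l * x) * normal_pdf m s x =
  expR (l * m + l ^+ 2 * s ^+ 2 / 2) * normal_pdf (m + l * s ^+ 2) s x.
Proof.
move=> s0; rewrite !normal_pdfE// !(mulrCA _ (normal_peak s)); congr *%R.
by rewrite /normal_fun -!expRD; congr expR; field.
Qed.

Lemma integral_expR_mul_normal_pdf m s l : s != 0 ->
  (\int[leb]_x (expR (l * x) * normal_pdf m s x)%:E =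
   (expR (l * m + l ^+ 2 * s ^+ 2 / 2))%:E)%E.
Proof.
move=> s0; under eq_integral do rewrite expR_mul_normal_pdf// EFinM.
rewrite integralZl//; last exact: integrable_normal_pdf.
by rewrite integral_normal_pdf mule1.
Qed.

Lemma measurable_expR_mul_normal_pdf m s l :
  measurable_fun [set: R] (fun x => expR (l * x) * normal_pdf m s x).
Proof.
apply: measurable_funM; last exact: measurable_normal_pdf.
by apply: measurableT_comp => //; exact: measurable_funM.
Qed.

(** Chernoff bound: [1 <= expR (l * (y - x))] for [y >= x], and the right-hand side is integrated
    against the density. For [s = 0] the point mass is treated directly. *)
Lemma normal_law_tail_le m s l x : 0 <= l ->
  (normal_law m s `[x, +oo[
   <= (expR (l * m + l ^+ 2 * s ^+ 2 / 2 - l * x))%:E)%E.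
Proof.
move=> l0; rewrite /normal_law; have [->|s0] := eqVneq s 0.
  rewrite diracE lee_fin.
  case: (boolP (m \in _)) => /=; last by rewrite expR_ge0.
  rewrite inE/= in_itv/= andbT => xm.
  rewrite -[leLHS]expR0 ler_expR expr0n/= !(mulr0, mul0r) addr0 subr_ge0.
  exact: ler_wpM2l.
rewrite /normal_prob expRD mulrC EFinM -(integral_expR_mul_normal_pdf m l s0).
rewrite -ge0_integralZl//=; last first.
- by move=> y _; rewrite lee_fin mulr_ge0 ?expR_ge0 ?normal_pdf_ge0.
- by apply/measurable_EFinP; exact: measurable_expR_mul_normal_pdf.
rewrite integral_mkcond; apply: ge0_le_integral => //=.
- by move=> y _; apply: erestrict_ge0 => z _; rewrite lee_fin normal_pdf_ge0.
- apply/measurable_restrict => //; rewrite setTI; apply/measurable_funTS.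
  by apply/measurable_EFinP; exact: measurable_normal_pdf.
- apply: measurable_funeM; apply/measurable_EFinP.
  exact: measurable_expR_mul_normal_pdf.
move=> y _; rewrite patchE; case: ifPn => [|_]; last first.
  by rewrite -EFinM lee_fin !mulr_ge0 ?expR_ge0 ?normal_pdf_ge0.
rewrite inE/= in_itv/= andbT => xy.
rewrite -EFinM lee_fin mulrA -expRD ler_peMl ?normal_pdf_ge0//.
by rewrite -[leLHS]expR0 ler_expR addrC subr_ge0 ler_wpM2l.
Qed.

(** The Radon-Nikodym derivative and [normal_pdf] have equal integrals over all measurable sets, so
    they agree almost everywhere. *)
Lemma integral_normal_prob m s (f : R -> \bar R) : measurable_fun [set: R] f ->
  (forall x, 0 <= f x)%E ->
  (\int[normal_prob m s]_x f x = \int[leb]_x (f x * (normal_pdf m s x)%:E))%E.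
Proof.
move=> mf f0; have dom := normal_prob_dominates m s.
rewrite -(Radon_Nikodym_SigmaFinite.change_of_variables dom)//.
apply: ae_eq_integral => //.
- apply: emeasurable_funM => //; apply: (measurable_int leb).
  exact: Radon_Nikodym_SigmaFinite.f_integrable.
- apply: emeasurable_funM => //; apply/measurable_EFinP.
  exact: measurable_normal_pdf.
- apply: ae_eqe_mul2l; apply: integral_ae_eq => //.
  + exact: Radon_Nikodym_SigmaFinite.f_integrable.
  + by apply/measurable_EFinP; exact: measurable_normal_pdf.
  + by move=> E _ mE; rewrite -Radon_Nikodym_SigmaFinite.f_integral.
Qed.

End normal_distribution.

Lemma integral_sqr_normal_pdf {R : realType} (m s : R) : 0 < s ->
  (\int[lebesgue_measure]_x ((x - m) ^+ 2 * normal_pdf m s x)%:E =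
   (s ^+ 2)%:E * \int[lebesgue_measure]_x (x ^+ 2 * normal_pdf 0 1 x)%:E)%E.
Proof.
move=> s0; have sn0 : s != 0 by rewrite gt_eqF.
pose F (x : R^o) := (x - m) / s.
have F' : F^`()%classic = cst s^-1.
  apply/funext => x; rewrite /F derive1E deriveM// deriveD// derive_cst scaler0.
  by rewrite add0r derive_id derive_cst addr0 scaler1.
rewrite (@increasing_ge0_integration_by_substitutionT _ F
  (fun x => x ^+ 2 * normal_pdf 0 1 x)); first last.
- by move=> x; rewrite mulr_ge0 ?sqr_ge0 ?normal_pdf_ge0.
- move=> x; apply: cvgM; first exact: sqr_continuous.
  by apply: continuous_normal_pdf; rewrite oner_eq0.
- by apply/gt0_cvgMly; [rewrite invr_gt0|exact: cvg_addrr].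
- by apply/gt0_cvgMlNy; [rewrite invr_gt0|exact: cvg_addrr_Ny].
- by [].
- by rewrite F'; exact: is_cvg_cst.
- by rewrite F'; exact: is_cvg_cst.
- by rewrite F' => ?; exact: cvg_cst.
- by move=> x y xy; rewrite /F ltr_pM2r ?ltrD2r// invr_gt0.
rewrite -ge0_integralZl//=; last 3 first.
- apply/measurable_EFinP; rewrite F'; apply: measurable_funM => //.
  apply: measurableT_comp; last first.
    by apply: measurable_funM => //; exact: measurable_funB.
  apply: measurable_funM => //; exact: measurable_normal_pdf.
- move=> x _; rewrite F' lee_fin; apply: mulr_ge0; last by rewrite invr_ge0 ltW.
  by rewrite mulr_ge0 ?sqr_ge0 ?normal_pdf_ge0.
- by rewrite lee_fin sqr_ge0.
apply: eq_integral => x _; rewrite F' -EFinM /=; congr EFin.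
rewrite !normal_pdfE ?oner_eq0//= /normal_fun /normal_peak.
rewrite !fctE /= subr0 expr1n mul1r -mulrnAr.
rewrite sqrtrM ?sqr_ge0// sqrtr_sqr gtr0_norm//.
have -> : - (x - m) ^+ 2 / (s ^+ 2 *+ 2) = - F x ^+ 2 / 2 :> R.
  by rewrite /F; field.
have : Num.sqrt (pi *+ 2) != 0 :> R.
  by rewrite gt_eqF// sqrtr_gt0 mulrn_wgt0// pi_gt0.
move: (Num.sqrt _) (expR _) => a b a0; rewrite /F; field.
exact/andP.
Qed.

(** * Moments of a random variable with a normal law *)

Section moments.
Context {d : measure_display} {T : measurableType d} {R : realType}.
Variables (P : probability T R) (Y : {RV P >-> R}) (m s : R).
Hypotheses (Ylaw : has_normal_law P Y m s) (s_ge0 : 0 <= s).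
Local Notation leb := (@lebesgue_measure R).

Lemma ge0_integral_normal_law (f : R -> \bar R) : measurable_fun [set: R] f ->
  (forall x, 0 <= f x)%E ->
  (\int[P]_w f (Y w) = if (s == 0)%R then f m
                       else \int[leb]_x (f x * (normal_pdf m s x)%:E))%E.
Proof.
move=> mf f0.
(* [R] and [measurableTypeR R] carry convertible sigma-algebras under distinct
   displays; the normal law lives on the latter. *)
pose Y' : {RV P >-> measurableTypeR R} :=
  HB.pack_for {mfun T >-> measurableTypeR R} (Y : T -> measurableTypeR R)
    (isMeasurableFun.Build _ _ _ (measurableTypeR R) Y (measurable_funPT Y)).
rewrite -(ge0_integral_distribution Y')//.
have [s0|s0] := eqVneq s 0; last first.
  rewrite -integral_normal_prob//; apply: eq_measure_integral => A mA _.
  by have := Ylaw mA; rewrite /normal_law (negbTE s0).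
transitivity (\int[dirac (m : measurableTypeR R)]_x f x)%E.
  apply: eq_measure_integral => A mA _.
  by have := Ylaw mA; rewrite /normal_law s0 eqxx.
by rewrite integral_dirac// diracT mul1e.
Qed.

Lemma normal_law_mgf l :
  (\int[P]_w (expR (l * Y w))%:E = (expR (l * m + l ^+ 2 * s ^+ 2 / 2))%:E)%E.
Proof.
rewrite (ge0_integral_normal_law (f := fun x => (expR (l * x))%:E));
  last 2 first.
- by apply/measurable_EFinP/measurableT_comp => //; exact: measurable_funM.
- by move=> x; rewrite lee_fin expR_ge0.
have [->|s0] := eqVneq s 0; first by rewrite expr0n/= mulr0 mul0r addr0.
by rewrite -integral_expR_mul_normal_pdf.
Qed.

Let measurable_expRM l : measurable_fun setT (fun w => expR (l * Y w)).
Proof. by apply: measurableT_comp => //; exact: measurable_funM. Qed.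

Let integrable_expRM l : P.-integrable setT (fun w => (expR (l * Y w))%:E).
Proof.
apply/integrableP; split; first exact/measurable_EFinP.
under eq_integral do rewrite gee0_abs ?lee_fin ?expR_ge0//.
by rewrite normal_law_mgf ltry.
Qed.

(** From [1 + y ^+ 2 / 2 <= expR y] for [y >= 0], the square of [Y] is at most
    [2 * (expR Y + expR (- Y))], whose expectation the moment generating function shows to be
    finite. *)
Lemma normal_law_Lfun2 : (Y : T -> R) \in Lfun P 2%:E.
Proof.
rewrite inE; apply/andP; split; rewrite inE/=; first exact: measurable_funPT.
rewrite /finite_norm unlock /=; apply: poweR_lty.
apply: (@le_lt_trans _ _ (\int[P]_w
  (2%:E * ((expR (1 * Y w))%:E + (expR (-1 * Y w))%:E)))%E).
  apply: ge0_le_integral => //=.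
  - apply/measurable_EFinP/(measurableT_comp (measurable_powR _)).
    exact: measurableT_comp.
  - by apply: measurable_funeM; apply: emeasurable_funD; apply/measurable_EFinP.
  move=> w _; rewrite -EFinD -EFinM lee_fin powR_mulrn// mul1r mulN1r.
  have := expR_ge1Dxn 1 (normr_ge0 (Y w)).
  have : expR `|Y w| <= expR (Y w) + expR (- Y w).
    by case: (ger0P (Y w)) => _; rewrite ?lerDl ?lerDr expR_ge0.
  rewrite (_ : 2`! = 2)%N//; lra.
rewrite ge0_integralZl//=; last first.
- by move=> w _; rewrite -EFinD lee_fin addr_ge0 ?expR_ge0.
- by apply: emeasurable_funD; apply/measurable_EFinP.
rewrite ge0_integralD//=;
  try by [move=> w _; rewrite lee_fin expR_ge0|exact/measurable_EFinP].
by rewrite !normal_law_mgf -EFinD -EFinM ltry.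
Qed.

(* [expR y >= 1 + y] makes [0] a minimum of [l |-> E (exp (l Y)) - l * E Y], and
   the derivative there is [m - E Y]. *)
Lemma normal_law_expectation : ('E_P[Y] = m%:E)%E.
Proof.
have Y1 : (Y : T -> R) \in Lfun P 1.
  exact: (Lfun_subset12 (fin_num_measure P _ measurableT) normal_law_Lfun2).
have iY : P.-integrable setT (EFin \o Y) by exact/Lfun1_integrable.
have EYE := fineK (expectation_fin_num Y1).
set e := fine 'E_P[Y] in EYE.
pose f l : R := expR (l * m + l ^+ 2 * s ^+ 2 / 2) - l * e.
have f_ge l : f 0 <= f l.
  rewrite /f expr0n/= !mul0r addr0 expR0 subr0 lerBrDr -lee_fin EFinD EFinM.
  rewrite EYE unlock -normal_law_mgf -integralZl//.
  rewrite -[1%E in leLHS](probability_setT P) -[P setT]mul1e -integral_cst//.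
  have i1 : P.-integrable setT (cst 1%E) :=
    finite_measure_integrable_cst P 1 measurableT.
  have ilY : P.-integrable setT (fun w => l%:E * (Y w)%:E)%E :=
    integrableZl measurableT l iY.
  rewrite -integralD//=.
  apply: le_integral => //=.
  + by apply: integrableD.
  + by move=> w _; rewrite lee_fin expR_ge1Dx.
have f'E : is_derive (0 : R) 1 f (m - e).
  apply: is_derive_eq.
  rewrite /GRing.scale/= !(mulr0, mul0r, addr0, mulr1, expr0n)/=.
  by rewrite expR0 mul1r !add0r.
have f'0 : is_derive (0 : R) 1 f 0.
  apply: (@derive1_at_min _ _ (-1) 1) => //.
  by rewrite in_itv/=; lra.
have := @derive_val _ _ _ _ _ _ _ f'E; rewrite (@derive_val _ _ _ _ _ _ _ f'0).
by move=> /esym/subr0_eq ->.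
Qed.

(* The standard second moment is left unevaluated: it cancels in correlations. *)
Lemma normal_law_variance : ('V_P[Y] =
  (s ^+ 2)%:E * \int[leb]_x (x ^+ 2 * normal_pdf 0 1 x)%:E)%E.
Proof.
rewrite /variance unlock normal_law_expectation/= unlock.
rewrite (ge0_integral_normal_law (f := fun x => ((x - m) * (x - m))%:E));
  last 2 first.
- by apply/measurable_EFinP/measurable_funM; exact: measurable_funB.
- by move=> x; rewrite lee_fin -expr2 sqr_ge0.
have [->|s0] := eqVneq s 0; first by rewrite subrr expr0n/= !mul0r mul0e.
by rewrite -(integral_sqr_normal_pdf m) ?lt_def ?s0.
Qed.

End moments.

(** * Law of the residual of one variable on another *)

Section normal_residual.
Context {d : measure_display} {T : measurableType d} {R : realType}.
Variable P : probability T R.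

(** With [v] the common variance of [Y] and [Z] and [c] their covariance,
    [v * sW ^+ 2 = v + r ^+ 2 * v - 2 * r * c], and the correlation bound means [c >= r * v]. *)
Lemma normal_residual_sd_le (Y Z W : {RV P >-> R}) (m m' mW sW r : R) :
  has_normal_law P Y m 1 -> has_normal_law P Z m' 1 ->
  has_normal_law P W mW sW -> 0 <= sW ->
  (forall w, W w = Y w - r * Z w) -> 0 < r -> r <= correlation P Y Z ->
  mW = m - r * m' /\ sW ^+ 2 <= 1 - r ^+ 2.
Proof.
move=> Ylaw Zlaw Wlaw sW0 WE r0 rcor.
have Y2 := normal_law_Lfun2 Ylaw; have Z2 := normal_law_Lfun2 Zlaw.
have Pfin : P setT \is a fin_num := fin_num_measure P _ measurableT.
have Y1 := Lfun_subset12 Pfin Y2; have Z1 := Lfun_subset12 Pfin Z2.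
have YZ1 := Lfun2_mul_Lfun1 Y2 Z2.
have rZ2 : r \o* Z \in Lfun P 2%:E by rewrite Lfun_scale// ler1n.
have rZ1 : r \o* Z \in Lfun P 1 by rewrite Lfun_scale.
have WYZ : (W : T -> R) = (Y \- r \o* Z).
  by apply/funext => w; rewrite WE/= mulrC.
split.
  apply: EFin_inj; rewrite -(normal_law_expectation Wlaw) WYZ expectationB//.
  rewrite expectationZl// (normal_law_expectation Ylaw).
  by rewrite (normal_law_expectation Zlaw).
have := normal_law_variance Ylaw ler01; have := normal_law_variance Zlaw ler01.
have := normal_law_variance Wlaw sW0.
set V := (\int[_]_x _)%E; rewrite !expr1n !mul1e => VW VZ VY.
have Vfin : V \is a fin_num by rewrite -VY variance_fin_num.
move: VW; rewrite WYZ varianceB// varianceZ// covarianceZr// VY VZ.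
have cfin := covariance_fin_num Y1 Z1 YZ1.
move: rcor; rewrite /correlation VY VZ -(fineK Vfin) -(fineK cfin) /=.
set v := fine V; set c := fine _.
have v_ge0 : 0 <= v by rewrite fine_ge0// -VY variance_ge0.
rewrite -expr2 sqr_sqrtr// => rcv [vE].
(* Division by zero yields 0, so [v = 0] would make the correlation 0, against [0 < r]. *)
have v_gt0 : 0 < v.
  rewrite lt_def v_ge0 andbT; apply: contraTneq rcv => ->.
  by rewrite invr0 mulr0 -ltNge.
move: rcv; rewrite ler_pdivlMr// => rcv.
rewrite -(ler_pM2r v_gt0) -vE; nra.
Qed.

Lemma jointly_normal_residual (X : nat -> {RV P >-> R}) (mu : nat -> R)
    (i j : nat) (r : R) :
  jointly_normal P X -> (forall k, has_normal_law P (X k) (mu k) 1) ->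
  i != j -> 0 < r -> r <= correlation P (X i) (X j) ->
  exists2 s, s ^+ 2 <= 1 - r ^+ 2 &
    has_normal_law P (fun w => X i w - r * X j w) (mu i - r * mu j) s.
Proof.
move=> Xjoint Xlaw ij r0 rcor.
pose W : {RV P >-> R} := (X i - r *: X j : {mfun T >-> R}).
have WE w : W w = X i w - r * X j w by [].
pose n := (maxn i j).+1.
have ltin : (i < n)%N by rewrite ltnS leq_maxl.
have ltjn : (j < n)%N by rewrite ltnS leq_maxr.
(* Coefficients 1 at [i], [- r] at [j] and 0 elsewhere exhibit the residual as a linear combination
   covered by joint normality. *)
pose c (k : 'I_n) : R := (k == Ordinal ltin)%:R - r * (k == Ordinal ltjn)%:R.
have [m [s [s0 mslaw]]] := Xjoint n c.
have cE : (fun w => \sum_(k < n) c k * X k w) = W.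
  apply/funext => w; rewrite WE.
  under eq_bigr do rewrite mulrBl -mulrA.
  rewrite sumrB -mulr_sumr; congr (_ - r * _).
    rewrite (bigD1 (Ordinal ltin))//= eqxx mul1r big1 ?addr0// => k /negbTE ->.
    by rewrite mul0r.
  rewrite (bigD1 (Ordinal ltjn))//= eqxx mul1r big1 ?addr0// => k /negbTE ->.
  by rewrite mul0r.
rewrite cE in mslaw.
have [mE sle] := normal_residual_sd_le (Xlaw i) (Xlaw j) mslaw s0 WE r0 rcor.
by exists s; rewrite // -mE.
Qed.

End normal_residual.

(** * Lower bound and measurability for p-values *)

Section pvalues.
Context {R : realType}.
Implicit Types x y : R.

(** The density decreases on the nonnegative half-line, so on this interval of length 1 it is at
    least its value at [y + 1]. *)
Lemma normal_prob_itv_ge y : 0 <= y ->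
  ((normal_peak 1 * expR (- (y + 1) ^+ 2 / 2))%:E
   <= normal_prob (0 : R) 1 `]y, (y + 1)%R])%E.
Proof.
move=> y0; set c := (X in X%:E).
have -> : (c%:E = \int[lebesgue_measure]_(x in `]y, (y + 1)%R]) cst c%:E x)%E.
  rewrite integral_cst//= lebesgue_measure_itv/= lte_fin ltrDl ltr01.
  by rewrite -EFinB -EFinM addrAC subrr add0r mulr1.
apply: ge0_le_integral => //=.
- by move=> x _; rewrite lee_fin mulr_ge0 ?normal_peak_ge0 ?expR_ge0.
- by apply/measurable_EFinP/measurable_funTS; exact: measurable_normal_pdf.
move=> x; rewrite in_itv/= => /andP[yx xy1].
rewrite lee_fin normal_pdfE ?oner_eq0//= ler_wpM2l ?normal_peak_ge0//.
rewrite /normal_fun ler_expR subr0 expr1n !mulNr lerN2 ler_wpM2r//.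
rewrite ler_sqr ?nnegrE//; lra.
Qed.

Lemma pvalue_ge x y : 0 <= y -> x <= y ->
  normal_peak 1 * expR (- (y + 1) ^+ 2 / 2) <= pvalue x.
Proof.
move=> y0 xy; rewrite /pvalue /std_normal_cdf lerBrDr -lee_fin EFinD.
rewrite fineK; last exact: fin_num_measure.
apply: (@le_trans _ _ (normal_prob (0 : R) 1 `]y, (y + 1)%R]
                       + normal_prob 0 1 `]-oo, x])%E).
  by rewrite leeD2r// normal_prob_itv_ge.
rewrite -measureU//; first by rewrite probability_le1//; exact: measurableU.
apply/seteqP; split => // z []/=; rewrite !in_itv/= => /andP[yz _] zx.
by have := lt_le_trans yz (le_trans zx xy); rewrite ltxx.
Qed.

Lemma measurable_pvalue : measurable_fun [set: R] (@pvalue R).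
Proof.
apply: measurable_funB => //; apply: nondecreasing_measurable => // x y xy.
rewrite /std_normal_cdf fine_le ?fin_num_measure//.
apply: le_measure; rewrite ?inE//.
by apply: subset_itvl; rewrite bnd_simp.
Qed.

End pvalues.

Lemma has_normal_law_tail_le {d : measure_display} {T : measurableType d}
    {R : realType} (P : probability T R) (Y : T -> R) (m s l x : R) :
  has_normal_law P Y m s -> 0 <= l ->
  (P [set w | (x <= Y w)%R]
   <= (expR (l * m + l ^+ 2 * s ^+ 2 / 2 - l * x))%:E)%E.
Proof.
move=> Ylaw l0; rewrite (_ : [set w | _] = Y @^-1` `[x, +oo[).
  by rewrite Ylaw//; exact: normal_law_tail_le.
by apply/seteqP; split => w /=; rewrite in_itv/= andbT.
Qed.

(** Such an event is a finite union of cells, one for each pattern of outcomes of the tests. *)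
Lemma measurable_finite_tests {d : measure_display} {T : measurableType d}
    (I : finType) (b : I -> T -> bool) (E : set T) :
  (forall k, measurable_fun setT (b k)) ->
  (forall w w', (forall k, b k w = b k w') -> E w -> E w') -> measurable E.
Proof.
move=> mb EP.
pose pat w := [ffun k => b k w].
have -> : E = \bigcup_(v in pat @` E) (pat @^-1` [set v]).
  apply/seteqP; split => [w Ew|w [_ [w' Ew' <-]] /= patE].
    by exists (pat w) => //; exists w.
  by apply: EP Ew' => k; have /ffunP/(_ k) := patE; rewrite !ffunE.
apply: fin_bigcup_measurable => [|v _]; first exact: finite_finset.
rewrite (_ : _ @^-1` _ = \bigcap_(k in [set: I]) (b k @^-1` [set v k])).
  apply: fin_bigcap_measurable => [|k _]; first exact: finite_finset.
  by rewrite -[_ @^-1` _]setTI; exact: mb.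
apply/seteqP; split => w /= => [<- k _|wv]; first by rewrite /= ffunE.
by apply/ffunP => k; rewrite ffunE; exact: wv.
Qed.

(** * Step-down procedures: first cutoff and measurability *)

Section step_down.
Context {R : realType} {n : nat}.
Implicit Types (u : nat -> R) (p q : 'I_n -> R).

Lemma ordered_pvalue_witness p q k : ordered_hyp p = ordered_hyp q ->
  (0 < k <= n)%N ->
  exists i, ordered_pvalue p k = p i /\ ordered_pvalue q k = q i.
Proof.
move=> pq /andP[k0 kn].
have ltkn : (k.-1 < n)%N by case: k k0 kn.
have szp : (k.-1 < size (ordered_hyp p))%N by rewrite size_sort -cardE card_ord.
exists (nth (Ordinal ltkn) (ordered_hyp p) k.-1); rewrite /ordered_pvalue.
by rewrite !(nth_map (Ordinal ltkn)) -?pq.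
Qed.

(** The pairwise comparisons fix the ordering, and the comparisons with the cutoffs then fix the
    count. This makes rejection events depend on finitely many tests. *)
Lemma eq_step_down u p q :
  (forall i j, (p i <= p j) = (q i <= q j)) ->
  (forall i (k : 'I_n), (p i <= u k.+1) = (q i <= u k.+1)) ->
  step_down u p = step_down u q.
Proof.
move=> pq upq.
have hypE : ordered_hyp p = ordered_hyp q.
  by congr sort; apply/funext => i; apply/funext => j; exact: pq.
rewrite /step_down hypE.
suff -> : step_down_count u p = step_down_count u q by [].
rewrite /step_down_count big_seq_cond [RHS]big_seq_cond.
apply: eq_bigl => i; rewrite mem_index_iota.
have [/andP[i0 ilt]/=|//] := boolP (_ <= _ < _)%N.
apply: eq_in_all => k; rewrite mem_iota => /andP[k0 klt].
have kn : (0 < k <= n)%N by rewrite k0/=; lia.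
have [j [-> ->]] := ordered_pvalue_witness hypE kn.
have ltkn : (k.-1 < n)%N by case: k k0 kn {klt}.
by have := upq j (Ordinal ltkn); rewrite /= prednK.
Qed.

(** Any rejection needs a positive count, and every admissible count includes the test of the
    smallest p-value against the first cutoff. *)
Lemma step_down_first u p i0 : i0 \in step_down u p -> exists i, p i <= u 1%N.
Proof.
rewrite inE => i0take.
have n_gt0 : (0 < n)%N by apply: leq_ltn_trans (ltn_ord i0).
have : (0 < step_down_count u p)%N.
  by case: (step_down_count u p) i0take => //; rewrite take0.
rewrite lt0n; apply: contraTP => /forallNP pu; rewrite negbK.
rewrite /step_down_count big_seq_cond big1// => i.
rewrite mem_index_iota => /andP[/andP[i_gt0 _]].
case: i i_gt0 => //= i _ /andP[+ _].
have [j [-> _]] :=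
  ordered_pvalue_witness (erefl (ordered_hyp p)) (k := 1) n_gt0.
by move=> /(pu j).
Qed.

Lemma measurable_step_down {d : measure_display} {T : measurableType d}
    u (p : 'I_n -> T -> R) (Q : pred {set 'I_n}) :
  (forall i, measurable_fun setT (p i)) ->
  measurable [set w | Q (step_down u (fun i => p i w))].
Proof.
move=> mp.
pose b (k : 'I_n * 'I_n + 'I_n * 'I_n) (w : T) : bool := match k with
  | inl ij => p ij.1 w <= p ij.2 w
  | inr ik => p ik.1 w <= u ik.2.+1
  end.
apply: (@measurable_finite_tests _ _ _ b) => [[[i j]|[i k]]|w w' bE /=].
- exact: measurable_fun_ler.
- exact: measurable_fun_ler.
rewrite (_ : step_down u _ = step_down u (fun i => p i w'))//.
apply: eq_step_down => [i j|i k]; first exact: (bE (inl (i, j))).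
exact: (bE (inr (i, k))).
Qed.

End step_down.

(** * Reading off the lower limit and inverting small p-values *)

Section asymptotics.
Context {R : realType}.

Lemma liminf_offdiag_gt (rho : nat -> nat -> R) (r : R) :
  (r%:E < liminf_offdiag rho)%E ->
  exists N, forall i j, (N <= i)%N -> (N <= j)%N -> i != j -> r <= rho i j.
Proof.
rewrite /liminf_offdiag limf_einfE => /ereal_sup_gt[_ [V /= VF <-] rV].
have [[A B] /= [[NA _ NAA] [NB _ NBB]] ABV] := VF.
exists (maxn NA NB) => i j; rewrite !geq_max => /andP[NAi _] /andP[_ NBj] ij.
rewrite -lee_fin (le_trans (ltW rV))//; apply: ereal_inf_lbound.
exists (i, j) => //; apply: (ABV (i, j)) => //.
by split; [exact: NAA|exact: NBB].
Qed.

(** If [x < t - 2], the p-value is at least [c * expR (- (t - 1) ^+ 2 / 2)], which exceeds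
    [c * expR (- t ^+ 2 / 2)] by the factor [expR (t - 2^-1)]; for large [t] this beats
    [alpha / c]. *)
Lemma pvalue_le_inv (alpha : R) : exists t0 : R, 0 < t0 /\ forall t x : R,
  t0 <= t -> pvalue x <= alpha * expR (- t ^+ 2 / 2) -> t - 2 <= x.
Proof.
pose c : R := normal_peak 1.
have c_gt0 : 0 < c by rewrite normal_peak_gt0 ?oner_eq0.
(* The 2 makes [t - 2] nonnegative; the other term gives [1 + (t - 2^-1) > alpha / c], enough by
   [expR_ge1Dx]. *)
exists (2 + `|alpha| / c); split=> [|t x t0t].
  by rewrite ltr_wpDr// divr_ge0// ltW.
have t2 : 2 <= t by apply: le_trans t0t; rewrite lerDl divr_ge0// ltW.
apply: contraLR; rewrite -!ltNge => xt.
apply: lt_le_trans (pvalue_ge (y := t - 2) _ (ltW xt)); last first.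
  by rewrite subr_ge0.
have -> : - (t - 2 + 1) ^+ 2 / 2 = - t ^+ 2 / 2 + (t - 2^-1) :> R by field.
rewrite expRD mulrCA [ltLHS]mulrC ltr_pM2l ?expR_gt0// -/c.
rewrite mulrC -ltr_pdivrMr//.
apply: lt_le_trans (expR_ge1Dx _).
have : alpha / c <= `|alpha| / c.
  by apply: ler_wpM2r; rewrite ?ler_norm// invr_ge0 ltW.
lra.
Qed.

End asymptotics.

Lemma measurable_superlevel {d : measure_display} {T : measurableType d}
    {R : realType} (f : T -> R) (x : R) :
  measurable_fun setT f -> measurable [set w | x <= f w].
Proof.
move=> mf; rewrite (_ : [set w | _] = f @^-1` `[x, +oo[).
  by rewrite -[_ @^-1` _]setTI; exact: mf.
by apply/seteqP; split => w /=; rewrite in_itv/= andbT.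
Qed.

(** * Probability that some variable exceeds the threshold *)

Section holm_bound.
Context {R : realType} {d : measure_display} {T : measurableType d}.
Variables (P : probability T R) (X : nat -> {RV P >-> R}) (mu : nat -> R).
Hypothesis Xlaw : forall i, has_normal_law P (X i) (mu i) 1.
Variables (N : nat) (r M : R).
Hypotheses (r_gt0 : 0 < r) (r_lt1 : r < 1).
Hypothesis mu_le : forall i, mu i <= M.
Hypothesis mu_ge0 : forall i, 0 <= mu i.
Hypothesis residual_law : forall i, (N < i)%N ->
  exists2 s, s ^+ 2 <= 1 - r ^+ 2 &
  has_normal_law P (fun w => X i w - r * X N w) (mu i - r * mu N) s.

(** The three terms of the constant come from the common event [A], from the at most [N.+1] indices
    up to [N], and from the others, which contribute at most [n] times [n%:R^-1]. *)
Lemma exceedance_le (n : nat) (t : R) :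
  0 < t -> n%:R = expR (t ^+ 2 / 2) :> R -> M + 3 <= t * (r ^+ 2 / 4) ->
  (P (\big[setU/set0]_(i < n) [set w | (t - 2 <= X i w)%R])
   <= ((expR (M + 1 / 2) + expR (M + 5 / 2) * N.+1%:R + 1) *
       expR (- (r / 4 * t)))%:E)%E.
Proof.
move=> t0 nt tM.
pose A := [set w | r / 4 * t <= X N w].
pose B i := [set w | if (i <= N)%N then t - 2 <= X i w
                     else (1 - r ^+ 2 / 4) * t - 2 <= X i w - r * X N w].
have mX i (x : R) : measurable [set w | x <= X i w].
  exact: measurable_superlevel.
have mA : measurable A by exact: mX.
have mB i : measurable (B i).
  rewrite /B; case: (i <= N)%N; first exact: mX.
  apply: measurable_superlevel.
  by apply: measurable_funB => //; exact: measurable_funM.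
have PA : (P A <= (expR (M + 1 / 2) * expR (- (r / 4 * t)))%:E)%E.
  have := has_normal_law_tail_le (r / 4 * t) (Xlaw N) ler01.
  move=> /le_trans; apply; rewrite lee_fin -expRD ler_expR.
  have := mu_le N; lra.
have PB0 i : (i <= N)%N ->
    (P (B i) <= (expR (M + 5 / 2) * expR (- (r / 4 * t)))%:E)%E.
  move=> iN; rewrite /B iN.
  have := has_normal_law_tail_le (t - 2) (Xlaw i) ler01.
  move=> /le_trans; apply; rewrite lee_fin -expRD ler_expR.
  have : r * t <= t by rewrite ler_piMl ?ltW.
  have := mu_le i; lra.
have PB1 i : (N < i)%N ->
    (P (B i) <= (n%:R^-1 * expR (- (r / 4 * t)))%:E)%E.
  move=> Ni; rewrite /B leqNgt Ni/=.
  have [s sr Wlaw] := residual_law Ni.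
  have := has_normal_law_tail_le ((1 - r ^+ 2 / 4) * t - 2) Wlaw (ltW t0).
  move=> /le_trans; apply; rewrite lee_fin nt -expRN -expRD ler_expR.
  have mW : t * (mu i - r * mu N) <= t * M.
    rewrite ler_pM2l//; have := mu_le i.
    by have := mulr_ge0 (ltW r_gt0) (mu_ge0 N); lra.
  have t2s : t * t * s ^+ 2 <= t * t * (1 - r ^+ 2).
    by rewrite ler_pM2l// mulr_gt0.
  have rt : r * t <= t by rewrite ler_piMl ?ltW.
  (* The Chernoff exponent is at most [- t ^+ 2 / 2 - r ^+ 2 * t ^+ 2 / 4 + (M + 2) * t]. The first
     term is the factor [n%:R^-1]; by this inequality the rest is at most [- t]. *)
  have ttM : t * (M + 3) <= t * (t * (r ^+ 2 / 4)) by rewrite ler_pM2l.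
  lra.
have sub : \big[setU/set0]_(i < n) [set w | t - 2 <= X i w] `<=`
           A `|` \big[setU/set0]_(i < n) B i.
  move=> w; rewrite -(bigcup_mkord n (fun i => [set w | t - 2 <= X i w])).
  rewrite -bigcup_mkord => -[i /= ilt Xit].
  have [Aw|nAw] := pselect (A w); [by left|right].
  exists i => //; rewrite /B /=; case: ifPn => // _.
  (* Off [A], [r * X N w] stays below [r ^+ 2 / 4 * t], so the residual carries the remaining share
     of the threshold. *)
  move/negP: nAw; rewrite /A /= -ltNge => nAw.
  have : r * X N w <= r * (r / 4 * t) by rewrite ler_pM2l// ltW.
  nra.
apply: (@le_trans _ _ (P A + \sum_(i < n) P (B i))%E).
  apply: (@le_trans _ _ (P (A `|` \big[setU/set0]_(i < n) B i))).
    apply: le_measure => //; rewrite inE.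
    - by apply: bigsetU_measurable.
    - by apply: measurableU => //; apply: bigsetU_measurable.
  apply: (le_trans (measureU2 _ _ _)) => //; first exact: bigsetU_measurable.
  by rewrite leeD2l// Boole_inequality.
set e := expR (- _); set C := expR (M + 5 / 2).
have -> : (expR (M + 1 / 2) + C * N.+1%:R + 1) * e =
          expR (M + 1 / 2) * e + (N.+1%:R * (C * e) + e) by ring.
rewrite EFinD.
apply: leeD => //.
apply: (@le_trans _ _
  (\sum_(i < n) ((i < N.+1)%N%:R * (C * e) + n%:R^-1 * e)%:E)%E).
  apply: lee_sum => i _; have [iN|Ni] := leqP i N.
    rewrite (le_trans (PB0 _ iN))// lee_fin ltnS iN mul1r lerDl.
    by rewrite mulr_ge0 ?expR_ge0.
  by rewrite (le_trans (PB1 _ Ni))// lee_fin ltnS leqNgt Ni mul0r add0r.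
rewrite sumEFin lee_fin big_split/= -mulr_suml sumr_const card_ord.
rewrite lerD//.
  rewrite ler_wpM2r ?mulr_ge0 ?expR_ge0// -natr_sum ler_nat.
  have -> : (\sum_(i < n) (i < N.+1) = minn n N.+1)%N.
    elim: (n) => [|k IHk]; first by rewrite big_ord0 min0n.
    by rewrite big_ord_recr/= IHk; lia.
  exact: geq_minr.
by rewrite -[(_ * e) *+ n]mulr_natl mulrA divff ?mul1r// nt gt_eqF ?expR_gt0.
Qed.

End holm_bound.

(** * Choice of the constants and passage to the limit *)

Theorem theorem3p2 (R : realType) (d : measure_display) (T : measurableType d)
    (P : probability T R) (X : nat -> {RV P >-> R}) (mu : nat -> R)
    (rho : nat -> nat -> R) (delta : R)
    (X_joint : jointly_normal P X)
    (X_law : forall i, has_normal_law P (X i) (mu i) 1)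
    (mu_ge0 : forall i, 0 <= mu i)
    (Sigma_rho : forall (n : nat) (i j : 'I_n), i != j ->
       correlation_mx P X n i j = rho i j)
    (rho_ge0 : forall i j : nat, i != j -> 0 <= rho i j)
    (rho_liminf : liminf_offdiag rho = delta%:E)
    (delta_gt0 : 0 < delta)
    (mu_sup : (ereal_sup (range (fun i => (mu i)%:E)) < +oo)%E)
    (alpha : R) (alpha_gt0 : 0 < alpha) (alpha_lt1 : alpha < 1) :
  FWER P mu X (@holm R) n alpha @[n --> \oo] --> 0%E.
Proof.
pose r := Num.min (delta / 2) (1 / 2).
have r_gt0 : 0 < r by rewrite /r lt_min; apply/andP; split; lra.
have r_lt1 : r < 1 by rewrite /r gt_min; apply/orP; right; lra.
have [|N rhoN] := @liminf_offdiag_gt R rho r.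
  by rewrite rho_liminf lte_fin /r gt_min; apply/orP; left; lra.
have [M mu_le] : exists M, forall i, mu i <= M.
  have mu_ub i := ereal_sup_ubound (imageT (fun i => (mu i)%:E) i).
  move: mu_sup mu_ub; case: (ereal_sup _) => // [M _ mu_ub|_ /(_ 0%N)//].
  by exists M => i; rewrite -lee_fin.
have residual_law i : (N < i)%N -> exists2 s, s ^+ 2 <= 1 - r ^+ 2 &
    has_normal_law P (fun w => X i w - r * X N w) (mu i - r * mu N) s.
  move=> Ni; apply: jointly_normal_residual => //; first by rewrite gtn_eqF.
  (* The matrix of size [i.+1] has [i] as its last index and contains [N], so it displays the
     required correlation. *)
  have := Sigma_rho i.+1 ord_max (Ordinal (leqW Ni)).
  rewrite mxE -val_eqE/= gtn_eqF// => /(_ isT) ->.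
  by apply: rhoN => //; [exact: ltnW|rewrite gtn_eqF].
have [t0 [t0_gt0 t0P]] := pvalue_le_inv alpha.
pose t (n : nat) : R := Num.sqrt (2 * ln n%:R).
have tE n : (0 < n)%N -> n%:R = expR (t n ^+ 2 / 2).
  move=> n_gt0; rewrite /t sqr_sqrtr.
    by rewrite mulrAC divff// mul1r lnK// posrE ltr0n.
  by rewrite mulr_ge0// ln_ge0// ler1n.
have t_ge (b : R) : \forall n \near \oo, b <= t n.
  near=> n.
  have n_gt0 : (0 < n)%N by near: n; exact: nbhs_infty_gt.
  have : expR (b ^+ 2 / 2) <= n%:R by near: n; exact: nbhs_infty_ger.
  rewrite (tE n)// ler_expR ler_pM2r// => bt.
  rewrite (le_trans (ler_norm b))// -ler_sqr ?nnegrE ?sqrtr_ge0//.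
  by rewrite real_normK ?num_real.
pose K := expR (M + 1 / 2) + expR (M + 5 / 2) * N.+1%:R + 1.
have FWER_le : \forall n \near \oo,
    (0 <= FWER P mu X (@holm R) n alpha <= (K * expR (- (r / 4 * t n)))%:E)%E.
  near=> n; apply/andP; split; first exact: measure_ge0.
  have n_gt0 : (0 < n)%N by near: n; exact: nbhs_infty_gt.
  have tn0 : t0 <= t n by near: n; exact: t_ge.
  have tnM : (M + 3) / (r ^+ 2 / 4) <= t n by near: n; exact: t_ge.
  apply: le_trans (exceedance_le X_law r_gt0 r_lt1 mu_le mu_ge0 residual_law
    (lt_le_trans t0_gt0 tn0) (tE _ n_gt0) _); last first.
    by rewrite -ler_pdivrMr// divr_gt0// exprn_gt0.
  apply: le_measure; rewrite ?inE.
  - apply: (@measurable_step_down _ n _ _ _ (fun i w => pvalue (X i w))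
      (fun A => 0 < type_I_errors mu A)%N) => i.
    by apply: measurableT_comp => //; exact: measurable_pvalue.
  - by apply: bigsetU_measurable => i _; exact: measurable_superlevel.
  move=> w /=; rewrite card_gt0 => /finset.set0Pn[i0].
  rewrite inE => /andP[i0rej _].
  rewrite -(bigcup_mkord n (fun i => [set w | t n - 2 <= X i w])).
  have [i pi] := step_down_first i0rej.
  exists i => //=; apply: t0P => //.
  (* The first Holm cutoff has denominator [n - 1 + 1 = n], that is [expR (t n ^+ 2 / 2)]. *)
  by move: pi; rewrite subnK// (tE n)// mulNr expRN.
apply: (squeeze_cvge FWER_le); first exact: cvg_cst.
apply: cvg_EFin; first exact: nearW.
rewrite -[0](mulr0 K); apply: cvgMr.
have t_cvg : r / 4 * t n @[n --> \oo] --> +oo.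
  apply/cvgryPge => A; apply: filterS (t_ge (A / (r / 4))) => n.
  by rewrite ler_pdivrMr ?divr_gt0// mulrC.
exact: (cvg_comp _ _ t_cvg (@cvgr_expR R)).
Unshelve. all: by end_near.
Qed.
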